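(* Let $\delta\ge1$ and $a\in(0,1)$ be constants, let $\xi_0\ge0$, and let $\{\xi_t\}_{t\ge1}$ be defined by letting $\xi_{t+1}\in[a,1)$ be the solution of $$\frac{\xi_{t+1}(\xi_{t+1}-a)}{1-\xi_{t+1}}=\frac1\delta\,\xi_t^2 .$$ Then: 1. $\xi(\delta):=\frac{1}{2}\left(\sqrt{(\delta-1)^2+4\delta a}-(\delta-1)\right)$ is the unique fixed point of this recursion. 2. If $\xi_0>\xi(\delta)$, then $\xi_t$ decreases to $\xi(\delta)$ as $t\to\infty$; if $\xi_0=\xi(\delta)$, then $\xi_t=\xi(\delta)$ for all $t$; if $0\le\xi_0<\xi(\delta)$, then $\xi_t$ increases to $\xi(\delta)$ as $t\to\infty$. 3. For all $t$, $$|\xi_t-\xi(\delta)|\le\left(\frac{1}{\sqrt\delta}\left(1-\frac{4}{5+\sqrt5}\cdot\frac{a}{\sqrt\delta}\right)\right)^t|\xi_0-\xi(\delta)|,$$ i.e. the convergence is geometric.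
   Context: For each $\xi_t\ge 0$ the equation has exactly one solution $\xi_{t+1}$ in $[a,1)$, so the recursion defines a map $\xi_t\mapsto\xi_{t+1}$ from $\mathbb{R}_{\ge0}$ to $[a,1)$; ''fixed point'' refers to this map. *)

(* Defs.v *)
From Stdlib Require Import Reals Lra Psatz ClassicalEpsilon.
Local Open Scope R_scope.

Definition is_next (delta a x y : R) : Prop :=
  a <= y < 1 /\ y * (y - a) / (1 - y) = 1 / delta * x ^ 2.

Lemma is_next_exists_unique (delta a x : R) :
  1 <= delta -> 0 < a < 1 -> 0 <= x -> exists! y, is_next delta a x y.
Proof.
intros Hd Ha _.
set (c := 1 / delta * x ^ 2).
assert (Hc : 0 <= c).
{ unfold c; apply Rmult_le_pos; [|nra].
  unfold Rdiv; rewrite Rmult_1_l; left; apply Rinv_0_lt_compat; lra. }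
assert (E : forall y, a <= y < 1 ->
  (y * (y - a) / (1 - y) = c <-> y * y + (c - a) * y - c = 0)).
{ intros y Hy; split; intros H.
  - assert (y * (y - a) = c * (1 - y)) by (rewrite <- H; field; lra). lra.
  - assert (y * (y - a) = c * (1 - y)) as -> by lra. field; lra. }
set (D := (a - c) * (a - c) + 4 * c).
assert (HD : 0 <= D) by (unfold D; nra).
pose proof (sqrt_pos D) as Hs.
pose proof (sqrt_sqrt D HD) as HsD.
set (s := sqrt D) in *.
unfold D in HsD.
assert (H1 : a + c <= s) by (apply Rsqr_incr_0_var; unfold Rsqr; nra).
assert (H2 : s < 2 - a + c) by (apply Rsqr_incrst_0; unfold Rsqr; nra).
exists ((a - c + s) / 2); split.
- assert (Hy : a <= (a - c + s) / 2 < 1) by lra.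
  split; [exact Hy|]. apply (proj2 (E _ Hy)). nra.
- intros z [Hz Ez]. apply (proj1 (E _ Hz)) in Ez.
  assert (P : (z - (a - c + s) / 2) * (z - (a - c - s) / 2) = 0) by nra.
  apply Rmult_integral in P; lra.
Qed.

Definition next (delta a x : R) : R :=
  epsilon (inhabits 0) (is_next delta a x).

(* On nonnegative reals, [next delta a] is the map that [is_next] defines;
   its values at negative arguments play no role. *)
Lemma nextP (delta a x y : R) :
  1 <= delta -> 0 < a < 1 -> 0 <= x -> (next delta a x = y <-> is_next delta a x y).
Proof.
intros Hd Ha Hx.
destruct (is_next_exists_unique delta a x Hd Ha Hx) as [z [Hz Uz]].
assert (H : is_next delta a x (next delta a x))
  by (unfold next; apply epsilon_spec; exists z; exact Hz).
split; [intros <-; exact H|].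
intros Hy; rewrite <- (Uz _ H); apply Uz, Hy.
Qed.

Definition fixed_point (delta a x : R) : Prop := 0 <= x /\ next delta a x = x.

Definition xi_lim (delta a : R) : R :=
  1 / 2 * (sqrt ((delta - 1) ^ 2 + 4 * delta * a) - (delta - 1)).

Definition rate (delta a : R) : R :=
  1 / sqrt delta * (1 - 4 / (5 + sqrt 5) * (a / sqrt delta)).

(* Main.v *)
Require Import Defs.
From Stdlib Require Import Reals Lra Psatz.
Open Scope R_scope.

(** Write [l] for [xi_lim delta a] and [s] for [sqrt delta].  The number [l] is
    the positive root of [l ^ 2 + (delta - 1) * l = delta * a], which is the
    fixed-point equation divided by [l].  If [y] is the successor of [x],
    subtracting the fixed-point equation from the equation of the recursion
    factors exactly:

      [y - l = k * (x - l)]  with  [k = (x + l) * (1 - y) / (delta * y + l)].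

    Everything follows from the two-sided bound [0 < k <= rate delta a < 1]
    ([next_sub_lim]).  Positivity of [k] keeps the orbit on one side of [l],
    [k < 1] makes it move strictly towards [l] and excludes a second fixed
    point, and [k <= rate delta a] gives the geometric estimate, hence the
    convergence.

    For the upper bound, [z = x * (1 - y) / s] satisfies
    [z ^ 2 = y * (y - a) * (1 - y) = y ^ 2 - y * m] with
    [m = y ^ 2 + a - a * y], so [z <= y - m / 2] because
    [sqrt (1 - u) <= 1 - u / 2] for [u = m / y].  After this replacement the claim is a
    polynomial inequality; eliminating [delta * a] by the equation of [l] turns
    it into a sum of nonnegative terms ([slope_core]).  The constant
    [4 / (5 + sqrt 5)] enters only through its being in [(0, 3/4]]. *)

(** * The fixed point *)

Lemma xi_lim_quadratic (delta a : R) :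
  1 <= delta -> 0 < a ->
  xi_lim delta a ^ 2 + (delta - 1) * xi_lim delta a = delta * a.
Proof.
intros Hd Ha; unfold xi_lim.
assert (HD : 0 <= (delta - 1) ^ 2 + 4 * delta * a) by nra.
pose proof (sqrt_sqrt _ HD); nra.
Qed.

Lemma xi_lim_gt0 (delta a : R) : 1 <= delta -> 0 < a -> 0 < xi_lim delta a.
Proof.
intros Hd Ha; unfold xi_lim.
assert (H : sqrt ((delta - 1) ^ 2) < sqrt ((delta - 1) ^ 2 + 4 * delta * a))
  by (apply sqrt_lt_1; nra).
rewrite sqrt_pow2 in H by lra; lra.
Qed.

(** The quadratic equation reads [l * (1 - l) = delta * (l - a)]; outside
    [[a, 1)] one side would be positive and the other would not. *)
Lemma xi_lim_bounds (delta a : R) :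
  1 <= delta -> 0 < a < 1 -> a <= xi_lim delta a < 1.
Proof.
intros Hd Ha.
pose proof (xi_lim_quadratic delta a Hd (proj1 Ha)).
pose proof (xi_lim_gt0 delta a Hd (proj1 Ha)).
split.
- destruct (Rle_lt_dec a (xi_lim delta a)); [assumption|nra].
- destruct (Rlt_le_dec (xi_lim delta a) 1); [assumption|nra].
Qed.

Lemma is_next_xi_lim (delta a : R) :
  1 <= delta -> 0 < a < 1 -> is_next delta a (xi_lim delta a) (xi_lim delta a).
Proof.
intros Hd Ha.
pose proof (xi_lim_quadratic delta a Hd (proj1 Ha)) as Hq.
pose proof (xi_lim_bounds delta a Hd Ha) as Hb.
split; [exact Hb|].
set (l := xi_lim delta a) in *.
replace (l - a) with (l * (1 - l) / delta).
- field; lra.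
- replace (l * (1 - l)) with (delta * (l - a)) by lra; field; lra.
Qed.

Lemma is_next_cleared (delta a x y : R) :
  1 <= delta -> is_next delta a x y -> delta * (y * (y - a)) = x ^ 2 * (1 - y).
Proof.
intros Hd [Hy E].
replace (y * (y - a)) with (y * (y - a) / (1 - y) * (1 - y)) by (field; lra).
rewrite E; field; lra.
Qed.

(** * The contraction factor *)

Lemma sqrt5_const_bounds : 0 < 4 / (5 + sqrt 5) <= 3 / 4.
Proof.
assert (H : 1 <= sqrt 5) by (rewrite <- sqrt_1; apply sqrt_le_1; lra).
split.
- apply Rdiv_lt_0_compat; lra.
- apply (Rmult_le_reg_r (5 + sqrt 5)); [lra|].
  unfold Rdiv at 1; rewrite Rmult_assoc, Rinv_l; lra.
Qed.

Lemma sqrt_ge1 (delta : R) : 1 <= delta -> 1 <= sqrt delta.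
Proof. intros Hd; rewrite <- sqrt_1; apply sqrt_le_1; lra. Qed.

Lemma rate_bounds (delta a : R) :
  1 <= delta -> 0 < a < 1 -> 0 < rate delta a < 1.
Proof.
intros Hd Ha; unfold rate.
pose proof (sqrt_ge1 delta Hd) as Hs; set (s := sqrt delta) in *.
pose proof sqrt5_const_bounds as Hc; set (c := 4 / (5 + sqrt 5)) in *.
unfold Rdiv; rewrite Rmult_1_l.
assert (Hi : 0 < / s <= 1).
{ split; [apply Rinv_0_lt_compat; lra|].
  rewrite <- Rinv_1; apply Rinv_le_contravar; lra. }
assert (Hb : 0 < a * / s < 1) by nra.
assert (Hcb : 0 < c * (a * / s) < 1) by nra.
nra.
Qed.

(** The hypothesis on [z] bounds it by [y - m / 2], where
    [m = y ^ 2 + a - a * y].  The difference of the two sides is then at least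
    [s] times
    [s^2 y (y-a) / 2 + l^2 / 2 + (s-1)^2 l / 2 + s l y - c a s y - c a l / s],
    where [s^2 a] has been eliminated with the equation of [l].  Since
    [a <= l] and [a <= y], the term [s l y] absorbs [c a s y] and leaves at
    least [(1 - c) a l]; together with [l^2 / 2 >= a l / 2] this dominates
    [c a l] as soon as [c <= 3/4]. *)
Lemma slope_core (s a c l y z : R) :
  1 <= s -> 0 < a -> a <= l -> a <= y < 1 -> 0 < c <= 3 / 4 ->
  l ^ 2 + (s ^ 2 - 1) * l = s ^ 2 * a ->
  z ^ 2 = y * (y - a) * (1 - y) ->
  s * (s * (s * z + l * (1 - y))) <= (s ^ 2 * y + l) * (s - c * a).
Proof.
intros Hs Ha Hl Hy Hc Hq Hz.
set (m := y ^ 2 + a - a * y).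
assert (Hm : m <= y) by (unfold m; nra).
assert (Hzm : z <= y - m / 2).
{ apply Rsqr_incr_0_var; [|lra].
  unfold Rsqr; replace (z * z) with (z ^ 2) by ring; rewrite Hz.
  replace (y * (y - a) * (1 - y)) with (y * y - y * m) by (unfold m; ring).
  pose proof (pow2_ge_0 m); nra. }
assert (H1 : s * (s * (s * z)) <= s * (s * (s * (y - m / 2))))
  by (repeat apply Rmult_le_compat_l; lra).
assert (Hyy : 0 <= s * (s ^ 2 * (y * (y - a))))
  by (apply Rmult_le_pos; [lra|]; apply Rmult_le_pos; nra).
assert (Hsl : 0 <= s * ((s - 1) ^ 2 * l))
  by (apply Rmult_le_pos; [lra|]; apply Rmult_le_pos; [apply pow2_ge_0|lra]).
assert (Hrest : c * a * (s ^ 2 * y + l) <= s * (s * l * y + l ^ 2 / 2)).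
{ assert (Hay : c * a * y * s ^ 2 <= c * l * y * s ^ 2)
    by (apply Rmult_le_compat_r; [apply pow2_ge_0|];
        apply Rmult_le_compat_r; [lra|]; apply Rmult_le_compat_l; lra).
  assert (Hly : (1 - c) * (l * a) <= (1 - c) * (l * y) * s ^ 2).
  { assert (l * a <= l * y) by nra.
    assert (0 <= (1 - c) * (l * y)) by (apply Rmult_le_pos; nra).
    assert (1 <= s ^ 2) by nra.
    nra. }
  assert (Hll : l * a <= s * l ^ 2) by nra.
  assert (Hla : 0 <= l * a) by nra.
  nra. }
assert (Hid : (s ^ 2 * y + l) * s - s * (s * (s * (y - m / 2) + l * (1 - y)))
  = s * (s ^ 2 * (y * (y - a))) / 2 + s * ((s - 1) ^ 2 * l) / 2
    + s * (s * l * y + l ^ 2 / 2)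
    + s / 2 * (s ^ 2 * a - (l ^ 2 + (s ^ 2 - 1) * l))) by (unfold m; field).
rewrite Hq in Hid.
nra.
Qed.

(** The slope of the chord through [(l, l)] and [(x, y)] is known in closed
    form, so no mean value argument is needed, and it is bounded on both
    sides. *)
Lemma next_sub_lim (delta a x y : R) :
  1 <= delta -> 0 < a < 1 -> 0 <= x -> is_next delta a x y ->
  exists k, 0 < k <= rate delta a
    /\ y - xi_lim delta a = k * (x - xi_lim delta a).
Proof.
intros Hd Ha Hx Hn.
pose proof (is_next_cleared delta a x y Hd Hn) as E.
destruct Hn as [Hy _].
pose proof (xi_lim_quadratic delta a Hd (proj1 Ha)) as Hq.
pose proof (xi_lim_bounds delta a Hd Ha) as Hl.
unfold rate; set (l := xi_lim delta a) in *.
pose proof (sqrt_ge1 delta Hd) as Hs.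
pose proof (sqrt_sqrt delta ltac:(lra)) as Hss.
set (s := sqrt delta) in *.
pose proof sqrt5_const_bounds as Hc; set (c := 4 / (5 + sqrt 5)) in *.
assert (HD : 0 < delta * y + l) by nra.
exists ((x + l) * (1 - y) / (delta * y + l)); split; [split|].
- apply Rdiv_lt_0_compat; [|assumption].
  apply Rmult_lt_0_compat; lra.
- assert (Hz : (x * (1 - y) / s) ^ 2 = y * (y - a) * (1 - y)).
  { replace ((x * (1 - y) / s) ^ 2)
      with (x ^ 2 * (1 - y) * (1 - y) / (s * s)) by (field; lra).
    rewrite <- E, Hss; field; lra. }
  assert (Hqs : l ^ 2 + (s ^ 2 - 1) * l = s ^ 2 * a)
    by (replace (s ^ 2) with delta by lra; exact Hq).
  pose proof (slope_core s a c l y _ Hs (proj1 Ha) (proj1 Hl) Hy Hc Hqs Hz) as K.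
  replace (s * (x * (1 - y) / s) + l * (1 - y)) with ((x + l) * (1 - y)) in K
    by (field; lra).
  replace (s ^ 2) with delta in K by lra.
  apply (Rmult_le_reg_r (s * s * (delta * y + l))); [nra|].
  replace ((x + l) * (1 - y) / (delta * y + l) * (s * s * (delta * y + l)))
    with (s * (s * ((x + l) * (1 - y)))) by (field; lra).
  replace (1 / s * (1 - c * (a / s)) * (s * s * (delta * y + l)))
    with ((delta * y + l) * (s - c * a)) by (field; lra).
  exact K.
- apply (Rmult_eq_reg_r (delta * y + l)); [|lra].
  replace ((x + l) * (1 - y) / (delta * y + l) * (x - l) * (delta * y + l))
    with (x ^ 2 * (1 - y) - l ^ 2 * (1 - y)) by (field; lra).
  rewrite <- E.
  assert (F : delta * a * (y - l) = (l ^ 2 + (delta - 1) * l) * (y - l))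
    by (rewrite Hq; reflexivity).
  nra.
Qed.

(** * Consequences for orbits *)

Lemma xi_lim_unique_fixed_point (delta a : R) :
  1 <= delta -> 0 < a < 1 -> unique (fixed_point delta a) (xi_lim delta a).
Proof.
intros Hd Ha.
pose proof (xi_lim_gt0 delta a Hd (proj1 Ha)) as Hl.
pose proof (rate_bounds delta a Hd Ha) as Hr.
split.
- split; [lra|].
  apply nextP; [assumption..|lra|].
  apply is_next_xi_lim; assumption.
- intros x [Hx Ex].
  apply nextP in Ex; [|assumption..].
  destruct (next_sub_lim delta a x x Hd Ha Hx Ex) as [k [Hk Ek]].
  assert (P : (1 - k) * (x - xi_lim delta a) = 0) by lra.
  apply Rmult_integral in P; lra.
Qed.

Lemma orbit_ge0 (delta a : R) (xi : nat -> R) :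
  0 < a < 1 -> 0 <= xi 0%nat ->
  (forall t, is_next delta a (xi t) (xi (S t))) -> forall t, 0 <= xi t.
Proof.
intros Ha H0 Hxi [|t]; [assumption|].
destruct (Hxi t) as [Hy _]; lra.
Qed.

Lemma Un_cv_of_geometric (u : nat -> R) (l r C : R) :
  0 <= r < 1 -> (forall t, Rabs (u t - l) <= r ^ t * C) -> Un_cv u l.
Proof.
intros Hr Hu eps Heps.
assert (HC : 0 <= C).
{ specialize (Hu 0%nat); pose proof (Rabs_pos (u 0%nat - l)).
  simpl in Hu; lra. }
destruct (pow_lt_1_zero r ltac:(rewrite Rabs_pos_eq; lra) (eps / (C + 1)))
  as [N HN]; [apply Rdiv_lt_0_compat; lra|].
exists N; intros n Hn; unfold Rdist.
apply Rle_lt_trans with (1 := Hu n).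
specialize (HN n Hn); apply (Rle_lt_trans _ _ _ (Rle_abs _)) in HN.
assert (Hp : 0 <= r ^ n) by (apply pow_le; lra).
apply Rle_lt_trans with (r ^ n * (C + 1)); [nra|].
replace eps with (eps / (C + 1) * (C + 1)) by (field; lra).
apply Rmult_lt_compat_r; lra.
Qed.

Theorem lemmaC1 (delta a : R) (xi : nat -> R)
    (hdelta : 1 <= delta) (ha : 0 < a < 1) (hxi0 : 0 <= xi 0%nat)
    (hxi : forall t : nat, is_next delta a (xi t) (xi (S t))) :
  unique (fixed_point delta a) (xi_lim delta a)
  /\ ((xi 0%nat > xi_lim delta a ->
         (forall t : nat, xi (S t) < xi t) /\ Un_cv xi (xi_lim delta a))
      /\ (xi 0%nat = xi_lim delta a -> forall t : nat, xi t = xi_lim delta a)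
      /\ (0 <= xi 0%nat < xi_lim delta a ->
         (forall t : nat, xi t < xi (S t)) /\ Un_cv xi (xi_lim delta a)))
  /\ (0 < rate delta a < 1
      /\ forall t : nat,
           Rabs (xi t - xi_lim delta a)
             <= rate delta a ^ t * Rabs (xi 0%nat - xi_lim delta a)).
Proof.
pose proof (rate_bounds delta a hdelta ha) as Hr.
assert (step : forall t, exists k, 0 < k <= rate delta a
    /\ xi (S t) - xi_lim delta a = k * (xi t - xi_lim delta a)).
{ intros t; apply next_sub_lim; auto.
  apply (orbit_ge0 delta a xi); assumption. }
assert (geom : forall t, Rabs (xi t - xi_lim delta a)
    <= rate delta a ^ t * Rabs (xi 0%nat - xi_lim delta a)).
{ induction t as [|t IH]; [simpl; lra|].
  destruct (step t) as [k [Hk ->]].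
  rewrite Rabs_mult, (Rabs_pos_eq k) by lra; simpl; rewrite Rmult_assoc.
  apply Rmult_le_compat; try lra; apply Rabs_pos. }
assert (cv : Un_cv xi (xi_lim delta a))
  by (apply (Un_cv_of_geometric _ _ (rate delta a)
               (Rabs (xi 0%nat - xi_lim delta a))); [lra|exact geom]).
split; [apply xi_lim_unique_fixed_point; assumption|].
split; [|split; assumption].
split; [|split].
- intros H0; split; [|exact cv].
  assert (side : forall t, xi t > xi_lim delta a).
  { induction t as [|t IH]; [exact H0|].
    destruct (step t) as [k [Hk Ek]]; nra. }
  intros t; specialize (side t); destruct (step t) as [k [Hk Ek]]; nra.
- intros H0; induction t as [|t IH]; [exact H0|].
  destruct (step t) as [k [Hk Ek]]; rewrite IH in Ek; lra.
- intros [_ H0]; split; [|exact cv].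
  assert (side : forall t, xi t < xi_lim delta a).
  { induction t as [|t IH]; [exact H0|].
    destruct (step t) as [k [Hk Ek]]; nra. }
  intros t; specialize (side t); destruct (step t) as [k [Hk Ek]]; nra.
Qed.
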